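(* Let $p,q$ be integers with $p>1$ and $0<q<p$, and let $Q(i,j)$, $i,j\ge 0$, be the $(p,q)$-super Patalan numbers. Then for all integers $m,n\ge 0$, $$Q(m,n)=(-1)^n p^{2(m+n)}\binom{m-q/p}{m+n}.$$
   Context: Definition. For integers $p>1$ and $0<q<p$, the $(p,q)$-super Patalan numbers are the rational numbers $Q(i,j)$, $i,j\ge 0$, defined recursively by $Q(0,0)=1$; $Q(i,0)=\frac{p(pi-q)}{i}\,Q(i-1,0)$ for $i\ge 1$; and $Q(i,j)=\frac{p(pj-p+q)}{i+j}\,Q(i,j-1)$ for $i\ge 0$, $j\ge 1$. For rational $x$ and an integer $k\ge 0$, $\binom{x}{k}=\frac{x(x-1)\cdots(x-k+1)}{k!}$ is the generalized binomial coefficient. *)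

(* Defs.v *)
From mathcomp Require Import all_boot all_order all_algebra.

Set Implicit Arguments.
Unset Strict Implicit.
Unset Printing Implicit Defensive.

Import Order.TTheory GRing.Theory Num.Theory.
Local Open Scope ring_scope.

Definition gbinom (x : rat) (k : nat) : rat :=
  (\prod_(l < k) (x - l%:R)) / k`!%:R.

Fixpoint super_patalan_col0 (p q : int) (i : nat) : rat :=
  if i is i'.+1 then
    p%:Q * (p%:Q * i%:R - q%:Q) / i%:R * super_patalan_col0 p q i'
  else 1.

(* The (p,q)-super Patalan number Q(i,j); the boundary recursion in i is
   split off so that the main recursion is structural in j. *)
Fixpoint super_patalan (p q : int) (i j : nat) : rat :=
  if j is j'.+1 then
    p%:Q * (p%:Q * j%:R - p%:Q + q%:Q) / (i + j)%:R * super_patalan p q i j'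
  else super_patalan_col0 p q i.

(* Main.v *)
Require Import Defs.
From mathcomp Require Import all_boot all_order all_algebra.
From mathcomp Require Import ring.
Import Order.TTheory GRing.Theory Num.Theory.
Local Open Scope ring_scope.

(** Both recursions of [Q] are recursions of the generalized binomial
    coefficient at [x = m - q/p]: the one in [i] is the absorption identity
    [binom (x+1) (k+1) = (x+1)/(k+1) binom x k], the one in [j] is
    [binom x (k+1) = (x-k)/(k+1) binom x k] with [k = m + n]. *)

Lemma gbinom0 (x : rat) : gbinom x 0 = 1.
Proof. by rewrite /gbinom big_ord0 fact0 divr1. Qed.

Lemma gbinomS (x : rat) (k : nat) :
  gbinom x k.+1 = (x - k%:R) / k.+1%:R * gbinom x k.
Proof. by rewrite /gbinom big_ord_recr factS natrM invfM /=; ring. Qed.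

Lemma gbinomSS (x : rat) (k : nat) :
  gbinom (x + 1) k.+1 = (x + 1) / k.+1%:R * gbinom x k.
Proof.
rewrite /gbinom big_ord_recl factS natrM invfM subr0 /=.
(* With the index 0 factor [x + 1] split off, each other factor [x + 1 - (l + 1)] is [x - l]. *)
under eq_bigr => l _ do rewrite /bump add1n -natr1 opprD addrACA subrr addr0.
ring.
Qed.

Lemma super_patalan_col0E (p q : int) (m : nat) : p != 0 ->
  super_patalan_col0 p q m =
    p%:Q ^+ (2 * m) * gbinom (m%:R - q%:Q / p%:Q) m.
Proof.
move=> p0; have pQ0 : p%:Q != 0 by rewrite intr_eq0.
elim: m => [|m IHm]; first by rewrite gbinom0 mulr1.
(* [addrAC] exposes the upper argument as [(m - q/p) + 1]; then
   [p^2 (m + 1 - q/p) = p (p (m + 1) - q)]. *)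
rewrite /= IHm -natr1 addrAC gbinomSS mulnS exprD -natr1.
by field; rewrite pQ0 natr1 pnatr_eq0.
Qed.

Theorem theorem2p1 (p q : int) (hp : 1 < p) (hq0 : 0 < q) (hqp : q < p)
    (m n : nat) :
  super_patalan p q m n =
    (-1) ^+ n * p%:Q ^+ (2 * (m + n)) * gbinom (m%:R - q%:Q / p%:Q) (m + n).
Proof.
have p0 : p != 0 by rewrite gt_eqF // (lt_trans ltr01 hp).
have pQ0 : p%:Q != 0 by rewrite intr_eq0.
elim: n => [|n IHn]; first by rewrite /= super_patalan_col0E // addn0 mul1r.
(* The upper argument stays fixed: [(m - q/p) - (m + n) = -(n + q/p)] gives the sign, and
   [p^2 (n + q/p) = p (p (n + 1) - p + q)]. *)
rewrite /= IHn addnS gbinomS mulnS exprD exprS -!natr1 natrD.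
by field; rewrite pQ0 -natrD natr1 pnatr_eq0.
Qed.
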